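(* Let $A$ be any algebra. A collection of recognizable subsets of $A$ is a residuation ideal of $\mathrm{Rec}(A)$ if and only if it can be defined by a set of profinite algebra equations for $A$; that is, if and only if there is a set $\Sigma\subseteq\widehat A\times\widehat A$ such that the collection consists exactly of those $L\in\mathrm{Rec}(A)$ that satisfy $x\leq y$ for every $(x,y)\in\Sigma$.
   Context: $A$ is an algebra of some (finitary) type $\tau$. A subset $L\subseteq A$ is recognizable if $L=\varphi^{-1}(P)$ for some homomorphism $\varphi:A\to F$ into a finite algebra $F$ of type $\tau$ and some $P\subseteq F$; $\mathrm{Rec}(A)$ is the Boolean algebra of recognizable subsets, which is closed under the operations, for each $n$-ary $f\in\tau$ and $1\leq i\leq n$, $$f_i^\sharp(L_1,\ldots,L_{i-1},L_{i+1},\ldots,L_n,L)=\{a\in A\mid \forall a_j\in L_j\ (j\neq i):\ f(a_1,\ldots,a_{i-1},a,a_{i+1},\ldots,a_n)\in L\}.$$ A residuation ideal of $\mathrm{Rec}(A)$ is a bounded sublattice $\mathcal C$ of $\mathrm{Rec}(A)$ (containing $\emptyset$ and $A$, closed under binary union and intersection) such that $f_i^\sharp(K_1,\ldots,K_{i-1},K_{i+1},\ldots,K_n,L)\in\mathcal C$ for all $L\in\mathcal C$, all $K_j\in\mathrm{Rec}(A)$, all $f\in\tau$ and all $i$. The profinite completion $\widehat{A}$ is the inverse limit, as a topological algebra of type $\tau$, of the finite discrete algebras $A/\theta$, $\theta$ ranging over the congruences of $A$ of finite index. A point $x=(x_\theta)_\theta\in\widehat A$ is identified with the prime filter $F_x$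 of $\mathrm{Rec}(A)$ such that, for $L=q_\theta^{-1}(P)$ with $q_\theta:A\to A/\theta$ the quotient map and $P\subseteq A/\theta$, $L\in F_x\iff x_\theta\in P$. For $x,y\in\widehat A$, $L$ satisfies $x\to y$ iff ($L\in F_y$ implies $L\in F_x$). A linear unary polynomial $p$ over $\widehat A$ is a term in one variable $\Box$, in the type $\tau$ expanded with a constant symbol for each element of $\widehat A$ (interpreted as itself), in which the variable occurs exactly once; it induces a function $p^{\widehat A}:\widehat A\to\widehat A$. A profinite algebra equation for $A$ is a pair $x,y\in\widehat A$, written $x\leq y$; it is satisfied by $L\in\mathrm{Rec}(A)$ iff $L$ satisfies $p^{\widehat A}(x)\to p^{\widehat A}(y)$ for every linear unary polynomial $p$ over $\widehat A$. *)

(* Defs.v *)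
From mathcomp Require Import all_boot.
From mathcomp Require Import boolp classical_sets functions cardinality.
Set Implicit Arguments.
Unset Strict Implicit.
Unset Printing Implicit Defensive.
Local Open Scope classical_set_scope.

Record signature := Signature { op : Type; arity : op -> nat }.

(* The carrier may be empty if the signature has no constants. *)
Record algebra (tau : signature) := Algebra {
  carrier :> Type;
  interp : forall f : op tau, ('I_(arity f) -> carrier) -> carrier }.

Definition homomorphism (tau : signature) (A B : algebra tau) (phi : A -> B) :=
  forall (f : op tau) (v : 'I_(arity f) -> A),
    phi (interp v) = interp (fun i => phi (v i)).

Definition recognizable (tau : signature) (A : algebra tau) (L : set A) :=
  exists (F : algebra tau) (phi : A -> F) (P : set F),
    [/\ finite_set [set: F], homomorphism phi & L = phi @^-1` P].

(* The residual f_i^#; the value K i of the family K is ignored, so that K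
   stands for the family (K_j) indexed by the j <> i. *)
Definition residual (tau : signature) (A : algebra tau) (f : op tau)
    (i : 'I_(arity f)) (K : 'I_(arity f) -> set A) (L : set A) : set A :=
  [set a | forall v : 'I_(arity f) -> A,
     v i = a -> (forall j, j != i -> K j (v j)) -> L (interp v)].

Definition residuation_ideal (tau : signature) (A : algebra tau)
    (C : set (set A)) :=
  [/\ C `<=` @recognizable tau A,
      C set0 /\ C setT,
      forall L M, C L -> C M -> C (L `|` M),
      forall L M, C L -> C M -> C (L `&` M)
    & forall (f : op tau) (i : 'I_(arity f)) (K : 'I_(arity f) -> set A)
        (L : set A),
        (forall j, j != i -> recognizable (K j)) -> C L ->
        C (residual i K L)].

Record congruence (tau : signature) (A : algebra tau) := Congruence {
  cong_rel :> A -> A -> Prop;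
  cong_refl : forall a, cong_rel a a;
  cong_sym : forall a b, cong_rel a b -> cong_rel b a;
  cong_trans : forall a b c, cong_rel a b -> cong_rel b c -> cong_rel a c;
  cong_interp : forall (f : op tau) (v w : 'I_(arity f) -> A),
    (forall i, cong_rel (v i) (w i)) -> cong_rel (interp v) (interp w) }.

Definition quot_type (tau : signature) (A : algebra tau) (th : congruence A) :=
  {c : set A | exists a, c = th a}.

Definition quot_map (tau : signature) (A : algebra tau) (th : congruence A)
    (a : A) : quot_type th :=
  exist _ (th a : set A) (ex_intro _ a erefl).

Definition quot_repr (tau : signature) (A : algebra tau) (th : congruence A)
    (c : quot_type th) : A :=
  projT1 (cid (proj2_sig c)).

(* Operations are computed on chosen representatives; lemma quot_map_hom shows
   that the choice is irrelevant. *)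
Definition quotient (tau : signature) (A : algebra tau) (th : congruence A) :
    algebra tau :=
  @Algebra tau (quot_type th)
    (fun f v => quot_map th (interp (fun i => quot_repr (v i)))).

Lemma quot_reprK (tau : signature) (A : algebra tau) (th : congruence A)
    (c : quot_type th) : quot_map th (quot_repr c) = c.
Proof.
rewrite /quot_repr; case: cid => a /=.
by case: c => c cP /= cE; apply: eq_exist.
Qed.

Lemma quot_mapP (tau : signature) (A : algebra tau) (th : congruence A)
    (a b : A) : quot_map th a = quot_map th b <-> th a b.
Proof.
split=> [/(congr1 (@proj1_sig _ _)) /= ->|ab]; first exact: cong_refl.
apply: eq_exist => /=; apply/seteqP; split=> c /=.
  by move=> ac; apply: cong_trans ac; apply: cong_sym.
exact: cong_trans.
Qed.

Lemma quot_map_hom (tau : signature) (A : algebra tau) (th : congruence A) :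
  @homomorphism tau A (quotient th) (quot_map th).
Proof.
move=> f v; apply/quot_mapP/cong_interp => i.
by apply/quot_mapP; rewrite quot_reprK.
Qed.

Record fin_congruence (tau : signature) (A : algebra tau) := FinCongruence {
  fin_cong :> congruence A;
  fin_cong_index : finite_set [set: quotient fin_cong] }.

(* Points of the inverse limit: if th refines th', the transition map
   A/th -> A/th' sends the class of a modulo th to its class modulo th'. *)
Record profinite_type (tau : signature) (A : algebra tau) := Profinite {
  coord :> forall th : fin_congruence A, quotient th;
  coord_compat : forall th th' : fin_congruence A,
    (forall a b, th a b -> th' a b) ->
    forall a, coord th = quot_map th a -> coord th' = quot_map th' a }.

Lemma profinite_interp_compat (tau : signature) (A : algebra tau) (f : op tau)
    (v : 'I_(arity f) -> profinite_type A) (th th' : fin_congruence A) :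
  (forall a b, th a b -> th' a b) ->
  forall a, interp (fun i => v i th) = quot_map th a ->
    interp (fun i => v i th') = quot_map th' a.
Proof.
move=> sub a /quot_mapP /sub aE; apply/quot_mapP.
apply: cong_trans aE; apply: cong_interp => i; apply/quot_mapP.
by rewrite quot_reprK; apply: (coord_compat sub); rewrite quot_reprK.
Qed.

(* Only the algebraic structure of the inverse limit is recorded: its topology
   enters neither the operations, nor F_x, nor satisfaction of equations. *)
Definition profinite_completion (tau : signature) (A : algebra tau) :
    algebra tau :=
  @Algebra tau (profinite_type A)
    (fun f v => Profinite (@profinite_interp_compat tau A f v)).

(* The filter F_x; point_filterP shows that it does not depend on the chosen
   presentation of L. *)
Definition point_filter (tau : signature) (A : algebra tau)
    (x : profinite_completion A) : set (set A) :=
  [set L | exists (th : fin_congruence A) (P : set (quotient th)),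
     L = quot_map th @^-1` P /\ P (coord x th)].

Definition sat_arrow (tau : signature) (A : algebra tau) (L : set A)
    (x y : profinite_completion A) :=
  point_filter y L -> point_filter x L.

Inductive upoly (tau : signature) (B : Type) : Type :=
| Box
| Cst of B
| App (f : op tau) of 'I_(arity f) -> upoly tau B.

Fixpoint occurrences (tau : signature) (B : Type) (p : upoly tau B) : nat :=
  match p with
  | Box => 1
  | Cst _ => 0
  | App f ps => \sum_(i < arity f) occurrences (ps i)
  end.

Definition linear_upoly (tau : signature) (B : Type) (p : upoly tau B) :=
  occurrences p = 1.

Fixpoint upoly_eval (tau : signature) (B : algebra tau) (p : upoly tau B)
    (x : B) : B :=
  match p with
  | Box => x
  | Cst b => b
  | App f ps => interp (fun i => upoly_eval (ps i) x)
  end.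

Definition sat_equation (tau : signature) (A : algebra tau) (L : set A)
    (x y : profinite_completion A) :=
  forall p : upoly tau (profinite_completion A), linear_upoly p ->
    sat_arrow L (upoly_eval p x) (upoly_eval p y).

Definition defined_by (tau : signature) (A : algebra tau) (C : set (set A))
    (Sigma : set (profinite_completion A * profinite_completion A)) :=
  C = [set L | recognizable L /\
         forall x y, Sigma (x, y) -> sat_equation L x y].

Lemma fin_meet (tau : signature) (A : algebra tau) (th1 th2 : fin_congruence A) :
  exists th : fin_congruence A, forall a b, th a b <-> th1 a b /\ th2 a b.
Proof.
have @th : congruence A.
  exists (fun a b => th1 a b /\ th2 a b).
  - by move=> a; split; apply: cong_refl.
  - by move=> a b [? ?]; split; apply: cong_sym.
  - by move=> a b c [? ?] [? ?]; split; apply: cong_trans; eassumption.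
  - by move=> f v w vw; split; apply: cong_interp => i; case: (vw i).
suff fin : finite_set [set: quotient th] by exists (FinCongruence fin).
pose h (c : quotient th) : quotient th1 * quotient th2 :=
  (quot_map th1 (quot_repr c), quot_map th2 (quot_repr c)).
have hinj : injective h.
  move=> c d hcd; rewrite -[c]quot_reprK -[d]quot_reprK; apply/quot_mapP.
  by split; apply/quot_mapP; [exact: (congr1 fst hcd)|exact: (congr1 snd hcd)].
have := finite_setX (fin_cong_index th1) (fin_cong_index th2).
rewrite setXTT => fin12.
have := @finite_preimage _ _ setT h _ fin12.
by rewrite preimage_setT; apply=> c d _ _; apply: hinj.
Qed.

Lemma point_filterP (tau : signature) (A : algebra tau)
    (x : profinite_completion A) (th : fin_congruence A)
    (P : set (quotient th)) :
  point_filter x (quot_map th @^-1` P) <-> P (coord x th).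
Proof.
split=> [[th' [P' [eqL P'x]]]|Px]; last by exists th, P.
have [m mE] := fin_meet th th'.
pose a := quot_repr (coord x m).
have xth : coord x th = quot_map th a.
  by apply: (@coord_compat _ _ x m); [move=> ? ? /mE[]|rewrite quot_reprK].
have xth' : coord x th' = quot_map th' a.
  by apply: (@coord_compat _ _ x m); [move=> ? ? /mE[]|rewrite quot_reprK].
rewrite xth; rewrite xth' in P'x.
have : (quot_map th' @^-1` P') a by [].
by rewrite -eqL.
Qed.

(* Main.v *)
Require Import Defs.
From mathcomp Require Import all_boot.
From mathcomp Require Import boolp classical_sets functions cardinality.
From mathcomp Require Import filter.

(** The statement combines a duality for lattices with a duality for
    operations.

    On the lattice side, the points of the profinite completion are the
    ultrafilters of the Boolean algebra of recognizable sets
    ([ultrafilter_point]), so the completion is its Stone space.  A compactness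
    argument then shows that every bounded sublattice of recognizable sets is
    cut out by the arrows [x -> y] satisfied by all its members
    ([sublattice_separation]).

    On the operation side, the [i]-th residual is adjoint to the operation of
    the completion: the residual of [L] by the [K j] lies in the filter of
    [z i] exactly when [L] lies in the filter of [f z] for all choices of the
    points [z j], [j != i], with [K j] in the filter of [z j].  The two
    implications are [residual_filter] and [residual_filter_converse].

    An equation is an arrow closed under linear polynomials, and a linear
    polynomial is a composite of basic translations, that is, of operations
    with all arguments but one fixed.  If [L] satisfies an equation, the
    adjunction turns an arrow between [p x] and [p y] for a residual of [L]
    into an arrow for [L] itself between points of the form [f (.., p x, ..)]
    and [f (.., p y, ..)]; so the sets satisfying an equation are closed under
    residuals.  Conversely, if [C] is a residuation ideal, the arrows satisfied
    by all of [C] are preserved by basic translations: it suffices to residuate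
    a member [L] of [C] by congruence classes approximating the fixed
    arguments.  Hence the arrows defining [C] as a lattice are equations. *)

Set Implicit Arguments.
Unset Strict Implicit.
Unset Printing Implicit Defensive.
Local Open Scope classical_set_scope.

(** * Recognizable sets and congruences *)

Definition saturated (tau : signature) (A : algebra tau) (th : congruence A)
    (L : set A) :=
  forall a b, th a b -> L a -> L b.

Lemma saturated_preimage (tau : signature) (A : algebra tau)
    (th : congruence A) (L : set A) :
  saturated th L -> quot_map th @^-1` (quot_map th @` L) = L.
Proof.
move=> satL; apply/seteqP; split=> [a [b Lb /quot_mapP ba]|a La].
  exact: satL ba Lb.
by exists a.
Qed.

(** Recognition by a homomorphism is replaced by its kernel, whose quotient
    injects into the recognizing finite algebra. *)
Lemma recognizableP (tau : signature) (A : algebra tau) (L : set A) :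
  recognizable L <-> exists th : fin_congruence A, saturated th L.
Proof.
split=> [[F [phi [P [finF phiM ->]]]]|[th satL]]; last first.
  exists (quotient th), (quot_map th), (quot_map th @` L); split.
  - exact: fin_cong_index.
  - exact: quot_map_hom.
  - by rewrite saturated_preimage.
have @ker : congruence A.
  exists (fun a b => phi a = phi b).
  - by [].
  - by move=> a b ->.
  - by move=> a b c -> ->.
  - by move=> f v w vw; rewrite !phiM; congr interp; apply/funext.
suff fin : finite_set [set: quotient ker].
  by exists (FinCongruence fin) => a b /= ab; rewrite ab.
pose h (c : quotient ker) := phi (quot_repr c).
have hinj : injective h.
  by move=> c d hcd; rewrite -[c]quot_reprK -[d]quot_reprK; apply/quot_mapP.
have := @finite_preimage _ _ setT h _ finF.
by rewrite preimage_setT; apply=> c d _ _; apply: hinj.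
Qed.

Lemma recognizable2 (tau : signature) (A : algebra tau) (L M : set A) :
  recognizable L -> recognizable M ->
  exists th : fin_congruence A, saturated th L /\ saturated th M.
Proof.
move=> /recognizableP[th1 satL] /recognizableP[th2 satM].
have [th thE] := fin_meet th1 th2; exists th.
by split=> a b /thE[ab1 ab2]; [exact: satL|exact: satM].
Qed.

(** The universal congruence has at most one class, also when the carrier is
    empty. *)
Lemma fin_congruenceT (tau : signature) (A : algebra tau) :
  exists th : fin_congruence A, forall a b, th a b.
Proof.
have @th : congruence A by exists (fun _ _ => True).
suff fin : finite_set [set: quotient th] by exists (FinCongruence fin).
have := @finite_preimage _ _ setT (fun _ : quotient th => tt) _
  (@finite_finset _ setT).
rewrite preimage_setT; apply=> c d _ _ _.
by rewrite -[c]quot_reprK -[d]quot_reprK; apply/quot_mapP.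
Qed.

Lemma recognizable_set0 (tau : signature) (A : algebra tau) :
  recognizable (set0 : set A).
Proof. by have [th _] := fin_congruenceT A; apply/recognizableP; exists th. Qed.

Lemma recognizable_setT (tau : signature) (A : algebra tau) :
  recognizable (setT : set A).
Proof. by have [th _] := fin_congruenceT A; apply/recognizableP; exists th. Qed.

Lemma recognizable_setU (tau : signature) (A : algebra tau) (L M : set A) :
  recognizable L -> recognizable M -> recognizable (L `|` M).
Proof.
move=> recL recM; have [th [satL satM]] := recognizable2 recL recM.
apply/recognizableP; exists th => a b ab.
by case=> [/(satL _ _ ab)|/(satM _ _ ab)]; [left|right].
Qed.

Lemma recognizable_setI (tau : signature) (A : algebra tau) (L M : set A) :
  recognizable L -> recognizable M -> recognizable (L `&` M).
Proof.
move=> recL recM; have [th [satL satM]] := recognizable2 recL recM.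
apply/recognizableP; exists th => a b ab.
by case=> /(satL _ _ ab) ? /(satM _ _ ab).
Qed.

Lemma recognizable_setC (tau : signature) (A : algebra tau) (L : set A) :
  recognizable L -> recognizable (~` L).
Proof.
move=> /recognizableP[th satL]; apply/recognizableP; exists th => a b ab nLa.
by move=> /(satL _ _ (cong_sym ab)).
Qed.

(** Congruent elements [a] give congruent values [f (.., a, ..)] for each choice
    of the other arguments, so they pass the same tests for membership in
    [L]. *)
Lemma saturated_residual (tau : signature) (A : algebra tau)
    (th : congruence A) (f : op tau) (i : 'I_(arity f))
    (K : 'I_(arity f) -> set A) (L : set A) :
  saturated th L -> saturated th (residual i K L).
Proof.
move=> satL a b ab resa v vi Kv.
pose w j := if j == i then a else v j.
have wv : th (interp w) (interp v).
  apply: cong_interp => j; rewrite /w; case: eqP => [->|_].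
    by rewrite vi.
  exact: cong_refl.
apply: satL wv _; apply: resa => [|j ji]; first by rewrite /w eqxx.
by rewrite /w (negPf ji); apply: Kv.
Qed.

(** * The filter of a point *)

Section Points.
Variables (tau : signature) (A : algebra tau).
Implicit Types (x y : profinite_completion A) (L M K : set A).

Lemma coord_repr x (th : fin_congruence A) :
  exists a, coord x th = quot_map th a.
Proof. by exists (quot_repr (coord x th)); rewrite quot_reprK. Qed.

(** Computations in the completion reduce to [A]: once a congruence recognizing
    the set at hand is fixed, a point can be replaced by an element of [A]. *)
Lemma point_filterE x (th : fin_congruence A) L a :
  saturated th L -> coord x th = quot_map th a ->
  (point_filter x L <-> L a).
Proof.
move=> satL xa; rewrite -{1}(saturated_preimage satL) point_filterP xa.
split=> [[b Lb /quot_mapP ba]|La]; first exact: satL ba Lb.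
by exists a.
Qed.

(** The element is an approximation of [x] modulo the meet of [th] with a
    congruence recognizing [K]. *)
Lemma point_filter_approx x K (th : fin_congruence A) :
  point_filter x K -> exists2 a, K a & coord x th = quot_map th a.
Proof.
move=> [th' [P [-> Px]]]; have [m mE] := fin_meet th th'.
have [a xa] := coord_repr x m; exists a.
  by rewrite /= -(coord_compat (th := m) (th' := th') _ xa) // => b c /mE[].
by apply: (coord_compat (th := m)) xa => b c /mE[].
Qed.

Lemma point_filter_recognizable x L : point_filter x L -> recognizable L.
Proof.
move=> [th [P [-> _]]]; apply/recognizableP; exists th => a b /quot_mapP ab /=.
by rewrite ab.
Qed.

Lemma point_filter_set0 x : ~ point_filter x set0.
Proof. by have [th _] := fin_congruenceT A; case/(point_filter_approx th). Qed.

Lemma point_filter_setT x : point_filter x setT.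
Proof.
have [th _] := fin_congruenceT A; have [a xa] := coord_repr x th.
exact/(point_filterE (th := th) _ xa).
Qed.

Lemma point_filterU x L M : recognizable L -> recognizable M ->
  (point_filter x (L `|` M) <-> point_filter x L \/ point_filter x M).
Proof.
move=> recL recM; have [th [satL satM]] := recognizable2 recL recM.
have [a xa] := coord_repr x th.
rewrite (point_filterE satL xa) (point_filterE satM xa).
apply: point_filterE xa => b c bc.
by case=> [/(satL _ _ bc)|/(satM _ _ bc)]; [left|right].
Qed.

Lemma point_filterI x L M : recognizable L -> recognizable M ->
  (point_filter x (L `&` M) <-> point_filter x L /\ point_filter x M).
Proof.
move=> recL recM; have [th [satL satM]] := recognizable2 recL recM.
have [a xa] := coord_repr x th.
rewrite (point_filterE satL xa) (point_filterE satM xa).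
by apply: point_filterE xa => b c bc; case=> /(satL _ _ bc) ? /(satM _ _ bc).
Qed.

Lemma point_filterC x L : recognizable L ->
  (point_filter x (~` L) <-> ~ point_filter x L).
Proof.
move=> /recognizableP[th satL]; have [a xa] := coord_repr x th.
rewrite (point_filterE satL xa); apply: point_filterE xa => b c bc nLb.
by move=> /(satL _ _ (cong_sym bc)).
Qed.

(** The canonical map from [A] to its completion. *)
Definition principal_point (a : A) : profinite_completion A.
Proof.
exists (fun th : fin_congruence A => quot_map th a) => th th' sub b.
by move=> /quot_mapP/sub ab; apply/quot_mapP.
Defined.

Lemma coord_interp (f : op tau) (z : 'I_(arity f) -> profinite_completion A)
    (th : fin_congruence A) (v : 'I_(arity f) -> A) :
  (forall j, coord (z j) th = quot_map th (v j)) ->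
  coord (interp z) th = quot_map th (interp v).
Proof.
move=> zv; rewrite (quot_map_hom th v).
change (coord (interp z) th) with
  (@interp tau (quotient th) f (fun j => coord (z j) th)).
by congr interp; apply/funext.
Qed.

(** * Compactness *)

Lemma ultrafilter_fiber (T I : Type) (U : set_system T) (f : T -> I) :
  UltraFilter U -> finite_set [set: I] ->
  exists c, U (f @^-1` [set c]).
Proof.
move=> ultraU /(@finite_seqP {classic I})[s sE].
have : U (f @^-1` [set` s]) by rewrite -sE preimage_setT; exact: filterT.
elim: s {sE} => [|c s IHs] Us.
  by case: (@filter_not_empty _ U _); apply: filterS Us => a.
case: (in_ultra_setVsetC (f @^-1` [set c]) ultraU) => [Uc|UnC].
  by exists c.
apply: IHs; apply: filterS (filterI Us UnC) => a /= [].
by rewrite in_cons => /orP[/eqP|].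
Qed.

(** Each finite quotient has exactly one class belonging to the ultrafilter,
    and these classes are compatible: the completion contains all ultrafilters
    of recognizable sets. *)
Lemma ultrafilter_point (U : set_system A) : UltraFilter U ->
  exists x : profinite_completion A,
    forall L, recognizable L -> (point_filter x L <-> U L).
Proof.
move=> ultraU.
pose spec (th : fin_congruence A) := ultrafilter_fiber (quot_map th) ultraU
  (fin_cong_index th).
pose cls th := projT1 (cid (spec th)).
have Ucls (th : fin_congruence A) : U (quot_map th @^-1` [set cls th]) :=
  projT2 (cid (spec th)).
have Umeet (P Q : set A) : U P -> U Q -> exists2 b, P b & Q b.
  by move=> UP UQ; have [b []] := filter_ex (filterI UP UQ); exists b.
have cls_compat (th th' : fin_congruence A) :
    (forall a b, th a b -> th' a b) ->
    forall a, cls th = quot_map th a -> cls th' = quot_map th' a.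
  move=> sub a clsa.
  have [b /= bth <-] := Umeet _ _ (Ucls th) (Ucls th').
  by apply/quot_mapP/sub/quot_mapP; rewrite bth.
exists (Profinite cls_compat) => L /recognizableP[th satL].
have [a xa] := coord_repr (Profinite cls_compat) th.
rewrite (point_filterE satL xa).
have clsa : cls th = quot_map th a by [].
split=> [La|UL].
  apply: filterS (Ucls th) => b /=; rewrite clsa => /quot_mapP ba.
  exact: satL (cong_sym ba) La.
have [b /= + Lb] := Umeet _ _ (Ucls th) UL.
by rewrite clsa => /quot_mapP ba; exact: satL ba Lb.
Qed.

(** Compactness of the completion: the sets [B i] generate a proper filter on
    [A], and an ultrafilter refining it is a point. *)
Lemma directed_point (I : Type) (D : set I) (B : I -> set A) :
  (exists i, D i) ->
  (forall i j, D i -> D j -> exists2 k, D k & B k `<=` B i `&` B j) ->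
  (forall i, D i -> B i !=set0) ->
  exists x : profinite_completion A,
    forall i L, D i -> recognizable L -> B i `<=` L -> point_filter x L.
Proof.
move=> D0 Ddir BN0.
have Fproper : ProperFilter (filter_from D B).
  by apply: filter_from_proper => //; exact: filter_from_filter.
have [U [ultraU FU]] := ultraFilterLemma Fproper.
have [x xU] := ultrafilter_point ultraU; exists x => i L Di recL BL.
by apply/xU => //; apply: FU; exists i.
Qed.

(** Two uses of compactness.  If [L] were not in [C], the sets [L `\` M], for
    [M] in [C] included in [L], would be nonempty and directed, hence have a
    common point [y], whose filter contains [L] but no such [M].  The sets
    [M `\` L], for [M] in [C] and in the filter of [y], are then nonempty and
    directed as well, and a common point [x] contradicts the hypothesis on
    [L]. *)
Lemma sublattice_separation (C : set (set A)) L :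
  C `<=` @recognizable tau A -> C set0 -> C setT ->
  (forall M N, C M -> C N -> C (M `|` N)) ->
  (forall M N, C M -> C N -> C (M `&` N)) ->
  recognizable L ->
  (forall x y, (forall M, C M -> sat_arrow M x y) -> sat_arrow L x y) ->
  C L.
Proof.
move=> Crec C0 CT CU CI recL Larrow; apply: contrapT => nCL.
have [y yP] : exists y : profinite_completion A, point_filter y L /\
    forall M, C M -> M `<=` L -> ~ point_filter y M.
  have [||M [CM ML]|y yP] :=
    @directed_point _ [set M | C M /\ M `<=` L] (fun M => L `\` M).
  - by exists set0; split.
  - move=> M N [CM ML] [CN NL]; exists (M `|` N).
      by split; [exact: CU|move=> a [/ML|/NL]].
    by move=> a [La nMN]; split; split=> // Na; apply: nMN; [left|right].
  - apply/set0P/negP => /eqP; rewrite setD_eq0 => LM.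
    by apply: nCL; rewrite (_ : L = M) //; apply/seteqP.
  - exists y; split=> [|M CM ML].
      by apply: (yP set0) => //; split.
    apply/(point_filterC y (Crec _ CM)); apply: (yP M) => //.
    exact: recognizable_setC (Crec _ CM).
have [yL yM] := yP.
have [||M [CM My]|x xP] :=
  @directed_point _ [set M | C M /\ point_filter y M] (fun M => M `\` L).
- by exists setT; split=> //; exact: point_filter_setT.
- move=> M N [CM My] [CN Ny]; exists (M `&` N).
    by split; [exact: CI|apply/(point_filterI y (Crec _ CM) (Crec _ CN))].
  by move=> a [[Ma Na] nLa]; split; split.
- apply/set0P/negP => /eqP; rewrite setD_eq0 => ML; exact: yM ML My.
- have : point_filter x (~` L).
    apply: (xP setT) => //; last exact: recognizable_setC.
    by split=> //; exact: point_filter_setT.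
  move/(point_filterC x recL); apply; apply: Larrow yL => M CM My.
  by apply: (xP M) => //; exact: Crec.
Qed.

(** * Residuals and the operations of the completion *)

Lemma residual_filter (f : op tau) (i : 'I_(arity f))
    (K : 'I_(arity f) -> set A) L (z : 'I_(arity f) -> profinite_completion A) :
  recognizable L -> point_filter (z i) (residual i K L) ->
  (forall j, j != i -> point_filter (z j) (K j)) ->
  point_filter (interp z) L.
Proof.
move=> /recognizableP[th satL] zi zK.
have approx j : {a | coord (z j) th = quot_map th a & j != i -> K j a}.
  apply: cid2; case: (eqVneq j i) => [->|ji].
    by have [a ?] := coord_repr (z i) th; exists a.
  by have [a ? ?] := point_filter_approx th (zK j ji); exists a.
pose v j := s2val (approx j).
have zv j : coord (z j) th = quot_map th (v j) by exact: s2valP (approx j).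
apply/(point_filterE satL (coord_interp zv)).
move/(point_filterE (saturated_residual satL) (zv i)): zi.
by apply=> // j ji; exact: (s2valP' (approx j)).
Qed.

(** The arguments tested by the residual in the positions [j != i] are elements
    of [A]; they enter the hypothesis as principal points. *)
Lemma residual_filter_converse (f : op tau) (i : 'I_(arity f))
    (K : 'I_(arity f) -> set A) L x :
  (forall j, j != i -> recognizable (K j)) -> recognizable L ->
  (forall z : 'I_(arity f) -> profinite_completion A,
     z i = x -> (forall j, j != i -> point_filter (z j) (K j)) ->
     point_filter (interp z) L) ->
  point_filter x (residual i K L).
Proof.
move=> recK /recognizableP[th satL] xL; have [a xa] := coord_repr x th.
apply/(point_filterE (saturated_residual satL) xa) => v vi Kv.
pose z j := if j == i then x else principal_point (v j).
have zv j : coord (z j) th = quot_map th (v j).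
  by rewrite /z; case: eqP => [->|]; rewrite ?vi.
apply/(point_filterE satL (coord_interp zv)); apply: xL => [|j ji].
  by rewrite /z eqxx.
rewrite /z (negPf ji).
have /recognizableP[thj satKj] := recK j ji.
by apply/(point_filterE satKj (a := v j)) => //; exact: Kv.
Qed.

End Points.

(** * Linear polynomials *)

Lemma linear_App (tau : signature) (B : Type) (f : op tau)
    (ps : 'I_(arity f) -> upoly tau B) :
  linear_upoly (App ps) <->
  exists2 i, linear_upoly (ps i) & forall j, j != i -> occurrences (ps j) = 0.
Proof.
rewrite /linear_upoly /=; split=> [sum1|[i pi pj]]; last first.
  by rewrite (bigD1 i) //= pi big1.
have [i pi] : exists i, occurrences (ps i) != 0.
  apply: contrapT => nex; move: sum1; rewrite big1 // => i _.
  by apply/eqP/negPn/negP => pi; apply: nex; exists i.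
move: sum1; rewrite (bigD1 i) //=.
have: 0 < occurrences (ps i) by rewrite lt0n.
case piE: (occurrences (ps i)) => [//|n] _.
rewrite addSn => -[/eqP]; rewrite addn_eq0 => /andP[/eqP n0].
rewrite sum_nat_eq0 => /forall_inP pj.
by exists i => [|j ji]; [rewrite piE n0|exact/eqP/pj].
Qed.

Lemma upoly_eval_const (tau : signature) (B : algebra tau) (p : upoly tau B)
    (x y : B) :
  occurrences p = 0 -> upoly_eval p x = upoly_eval p y.
Proof.
elim: p => //= f ps IH /eqP; rewrite sum_nat_eq0 => /forallP p0.
by congr interp; apply/funext => i; apply: IH; apply/eqP/(implyP (p0 i)).
Qed.

(** Linear polynomials are composites of basic translations, so a relation
    preserved by the latter is preserved by the former. *)
Lemma linear_upoly_ind (tau : signature) (B : algebra tau)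
    (R : B -> B -> Prop) :
  (forall (f : op tau) (i : 'I_(arity f)) (v w : 'I_(arity f) -> B),
     (forall j, j != i -> v j = w j) -> R (v i) (w i) ->
     R (interp v) (interp w)) ->
  forall (x y : B) (p : upoly tau B), linear_upoly p -> R x y ->
    R (upoly_eval p x) (upoly_eval p y).
Proof.
move=> RM x y p + Rxy; elim: p => //= f ps IH /linear_App[i pi pj].
by apply: (RM f i) => [j ji|]; [exact/upoly_eval_const/pj|exact: IH].
Qed.

Definition translate (tau : signature) (B : algebra tau) (f : op tau)
    (i : 'I_(arity f)) (z : 'I_(arity f) -> B) (p : upoly tau B) :
    upoly tau B :=
  App (fun j => if j == i then p else Cst tau (z j)).

Lemma linear_translate (tau : signature) (B : algebra tau) (f : op tau)
    (i : 'I_(arity f)) (z : 'I_(arity f) -> B) (p : upoly tau B) :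
  linear_upoly p -> linear_upoly (translate i z p).
Proof.
move=> linp; apply/linear_App; exists i => [|j /negPf ji]; first by rewrite eqxx.
by rewrite ji.
Qed.

Lemma eval_translate (tau : signature) (B : algebra tau) (f : op tau)
    (i : 'I_(arity f)) (z : 'I_(arity f) -> B) (p : upoly tau B) (x : B) :
  upoly_eval (translate i z p) x =
  interp (fun j => if j == i then upoly_eval p x else z j).
Proof. by congr interp; apply/funext => j /=; case: eqP. Qed.

(** * Equations and residuation ideals *)

Section Equations.
Variables (tau : signature) (A : algebra tau).
Implicit Types (x y : profinite_completion A) (L K : set A).

(** By adjunction, an arrow from [p x] to [p y] for the residual amounts to
    arrows for [L] along the translates of [p], again linear polynomials. *)
Lemma sat_equation_residual (f : op tau) (i : 'I_(arity f))
    (K : 'I_(arity f) -> set A) L x y :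
  (forall j, j != i -> recognizable (K j)) -> recognizable L ->
  sat_equation L x y -> sat_equation (residual i K L) x y.
Proof.
move=> recK recL eqL p linp resy.
apply: residual_filter_converse => // z zi zK.
have := eqL _ (linear_translate i z linp); rewrite !eval_translate.
rewrite (_ : (fun j => if j == i then upoly_eval p x else z j) = z); last first.
  by apply/funext => j; case: eqP => // ->.
apply; apply: (residual_filter (i := i) (K := K)) => // [|j ji].
  by rewrite eqxx.
by rewrite (negPf ji); exact: zK.
Qed.

Lemma residuation_ideal_equations
    (Sigma : set (profinite_completion A * profinite_completion A)) :
  residuation_ideal [set L : set A | recognizable L /\
    forall x y, Sigma (x, y) -> sat_equation L x y].
Proof.
split=> [L []//||L M [recL eqL] [recM eqM]|L M [recL eqL] [recM eqM]|].
- split.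
    split; first exact: recognizable_set0.
    by move=> x y _ p _ /point_filter_set0.
  split; first exact: recognizable_setT.
  by move=> x y _ p _ _; exact: point_filter_setT.
- split=> [|x y xy p linp]; first exact: recognizable_setU.
  rewrite /sat_arrow !point_filterU //.
  by case=> [/(eqL _ _ xy p linp)|/(eqM _ _ xy p linp)]; [left|right].
- split=> [|x y xy p linp]; first exact: recognizable_setI.
  rewrite /sat_arrow !point_filterI //.
  by case=> /(eqL _ _ xy p linp) ? /(eqM _ _ xy p linp).
- move=> f i K L recK [recL eqL]; split=> [|x y xy].
    have /recognizableP[th satL] := recL.
    by apply/recognizableP; exists th; exact: saturated_residual.
  by apply: sat_equation_residual => //; exact: eqL.
Qed.

(** Let [th] recognize [L].  The value [f (.., y, ..)] depends modulo [th] only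
    on the classes of the arguments, so residuating [L] by the classes of the
    fixed arguments gives a member of [C] in the filter of [y], hence of [x]. *)
Lemma residuation_ideal_translation (C : set (set A)) (f : op tau)
    (i : 'I_(arity f)) (v w : 'I_(arity f) -> profinite_completion A) :
  residuation_ideal C -> (forall j, j != i -> v j = w j) ->
  (forall L, C L -> sat_arrow L (v i) (w i)) ->
  forall L, C L -> sat_arrow L (interp v) (interp w).
Proof.
move=> [Crec _ _ _ Cres] vw Carrow L CL wL; have recL := Crec _ CL.
have /recognizableP[th satL] := recL.
pose K j : set A := quot_map th @^-1` [set coord (w j) th].
have wK j : point_filter (w j) (K j) by apply/point_filterP.
have recK j : recognizable (K j) := point_filter_recognizable (wK j).
apply: (residual_filter (i := i) (K := K)) => // [|j ji]; last by rewrite vw.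
apply: Carrow; first exact: Cres.
apply: residual_filter_converse => // z zi zK.
have zw j : coord (z j) th = coord (w j) th.
  have [->|ji] := eqVneq j i; first by rewrite zi.
  by have /point_filterP := zK j ji.
have [a wa] : exists a, coord (interp w) th = quot_map th a.
  exact: coord_repr.
apply/(point_filterE satL (a := a)); last exact/(point_filterE satL wa).
by rewrite -wa /=; congr quot_map; congr interp; apply/funext => j; rewrite zw.
Qed.

End Equations.

Theorem theorem4p12 (tau : signature) (A : algebra tau) (C : set (set A))
    (C_rec : forall L : set A, C L -> recognizable L) :
  residuation_ideal C <->
  exists Sigma : set (profinite_completion A * profinite_completion A),
    defined_by C Sigma.
Proof.
split=> [idealC|[Sigma ->]]; last exact: residuation_ideal_equations.
exists [set xy | forall L, C L -> sat_arrow L xy.1 xy.2].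
have [_ [C0 CT] CU CI _] := idealC.
apply/seteqP; split=> [L CL|L [recL eqL]].
  split=> [|x y Cxy p linp]; first exact: C_rec.
  pose R x y := forall L : set A, C L -> sat_arrow L x y.
  suff: R (upoly_eval p x) (upoly_eval p y) by apply.
  apply: linear_upoly_ind linp Cxy => f i v w.
  exact: residuation_ideal_translation.
apply: sublattice_separation => // x y Cxy.
(* the arrow itself is the instance of the equation at the variable *)
by apply: (eqL x y Cxy (Box _ _)).
Qed.
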